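(* Let $S$ be a sample graph and let $\mathcal{Q}$ be a group (finite set) of conjunctive queries that produce the instances of $S$ in a data graph $G$; i.e., each query in $\mathcal{Q}$ has one relational subgoal for each edge of $S$, so the relational subgoals of the queries in $\mathcal{Q}$ differ only in the order of the variables in their arguments. Then, for any partition of $\mathcal{Q}$ into several nonempty subgroups $\mathcal{Q}_1,\ldots,\mathcal{Q}_r$ ($r\ge 2$), $$\mathrm{OPT}(\mathcal{Q})\;\le\;\sum_{i=1}^{r}\mathrm{OPT}(\mathcal{Q}_i),$$ that is, the communication cost of computing all queries of $\mathcal{Q}$ by breaking $\mathcal{Q}$ into several subgroups is greater than or equal to the communication cost of computing $\mathcal{Q}$ by combining all its queries into one whole.
   Context: $E$ is the edge relation of the data graph, of size $e$; each undirected edge $\{X,Y\}$ of $S$ appears in each query of $\mathcal{Q}$ as exactly one relational subgoal, either $E(X,Y)$ or $E(Y,X)$. Let $V(S)$ be the node set of $S$ (equivalently, the variables of the queries). Each variable $v$ gets a share $x_v\ge 1$ (a real number, the number of buckets into which its values are hashed), and the number of reducers is $\prod_{v\in V(S)}x_v=k$, with $k$ given. For a nonempty subset $\mathcal{Q}'\subseteq\mathcal{Q}$, an edge $\{X,Y\}$ of $S$ has coefficient $c_{XY}(\mathcal{Q}')=2$ if both $E(X,Y)$ and $E(Y,X)$ occur among the queries of $\mathcal{Q}'$, and $c_{XY}(\mathcal{Q}')=1$ otherwise. The communication cost of evaluating all the queries of $\mathcal{Q}'$ together, with shares $x$, is $$\sum_{\{X,Y\}\in E(S)}c_{XY}(\mathcal{Q}')\,e\prod_{v\in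 V(S)\setminus\{X,Y\}}x_v ,$$ and $\mathrm{OPT}(\mathcal{Q}')$ is the minimum of this quantity over all shares $x_v\ge1$ with $\prod_v x_v=k$. The cost of evaluating several subgroups separately is the sum of their costs. *)

(* Defs.v *)
From mathcomp Require Import all_boot all_order all_algebra.
From mathcomp Require Import classical_sets reals.

Set Implicit Arguments.
Unset Strict Implicit.
Unset Printing Implicit Defensive.

Import Order.TTheory GRing.Theory Num.Theory.
Local Open Scope ring_scope.

Record sgraph := SGraph {
  vertex :> finType;
  adj : rel vertex;
  adj_sym : symmetric adj;
  adj_irr : irreflexive adj
}.

Definition edges (S : sgraph) : {set {set S}} :=
  [set [set p.1; p.2] | p : S * S & adj p.1 p.2].

(* The pair (X, Y) stands for the relational subgoal E(X,Y). *)
Definition is_query (S : sgraph) (sg : {set S * S}) : Prop :=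
  (forall X Y : S, (X, Y) \in sg -> adj X Y) /\
  (forall X Y : S, adj X Y -> ((X, Y) \in sg) (+) ((Y, X) \in sg)).

(* Queries are elements of a finite type T and [sg q] is the set of relational
   subgoals of q.  The map [sg] need not be injective: distinct queries may
   have the same relational subgoals (and differ, for instance, in their
   arithmetic comparisons, which do not affect the communication cost). *)
Definition occurs (S : sgraph) (T : finType) (sg : T -> {set S * S})
    (Q : {set T}) (X Y : S) : bool :=
  [exists q in Q, (X, Y) \in sg q].

Definition coef (S : sgraph) (T : finType) (sg : T -> {set S * S})
    (Q : {set T}) (f : {set S}) : nat :=
  if [exists X, exists Y,
        [&& f == [set X; Y], occurs sg Q X Y & occurs sg Q Y X]]
  then 2%N else 1%N.

Definition cost (R : realType) (S : sgraph) (T : finType)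
    (sg : T -> {set S * S}) (e : nat) (Q : {set T}) (x : S -> R) : R :=
  \sum_(f in edges S) (coef sg Q f)%:R * e%:R * \prod_(v | v \notin f) x v.

Definition feasible (R : realType) (S : sgraph) (k : R) (x : S -> R) : Prop :=
  (forall v, 1 <= x v) /\ \prod_(v : S) x v = k.

Definition is_min_cost (R : realType) (S : sgraph) (T : finType)
    (sg : T -> {set S * S}) (e : nat) (k : R) (Q : {set T}) (m : R) : Prop :=
  (exists2 x : S -> R, feasible k x & cost sg e Q x = m) /\
  (forall x : S -> R, feasible k x -> m <= cost sg e Q x).

(* The minimum exists whenever S has a vertex and 1 <= k, since then the set of
   feasible shares is nonempty and compact; [xget] would return the default
   value 0 only if there were no minimum. *)
Definition OPT (R : realType) (S : sgraph) (T : finType)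
    (sg : T -> {set S * S}) (e : nat) (k : R) (Q : {set T}) : R :=
  xget 0 (is_min_cost sg e k Q).

(* Main.v *)
Require Import Defs.
From mathcomp Require Import boolp classical_sets topology normedtype derive.
From mathcomp Require Import all_boot all_order all_algebra.
From mathcomp Require Import reals.

Set Implicit Arguments.
Unset Strict Implicit.
Unset Printing Implicit Defensive.

Import Order.TTheory GRing.Theory Num.Theory.
Local Open Scope ring_scope.

(** Let B(x) be the cost with every coefficient replaced by 1.  Coefficients lie
    in {1, 2}, so B(x) <= cost(Q', x) <= 2 B(x) for every group Q'.  Take two
    distinct subgroups with optimal shares x and y, where B(x) <= B(y), say;
    then OPT(Q) <= cost(Q, x) <= 2 B(x) <= B(x) + B(y), which is at most the
    sum of the two subgroup optima, and the other optima are nonnegative.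
    The optima of the subgroups are attained by compactness of the set of
    feasible shares. *)

Section Attained.
Import ArrowAsProduct.
Import numFieldNormedType.Exports.
Local Open Scope classical_set_scope.

(** [ArrowAsProduct] gives [I -> R] the product topology, so each evaluation at a coordinate is a
    continuous projection. *)
Lemma continuous_prod_coord (R : realType) (I : finType) (A : pred I) :
  continuous (fun x : I -> R => \prod_(i | A i) x i).
Proof.
apply: continuous_big => [|i _]; first exact: mul_continuous.
exact: (@proj_continuous I (fun=> R : topologicalType) i).
Qed.

Lemma continuous_cost (R : realType) (S : sgraph) (T : finType)
    (sg : T -> {set S * S}) (e : nat) (Q : {set T}) :
  continuous (cost sg e Q : (S -> R) -> R).
Proof.
apply: continuous_big => [|f _]; first exact: add_continuous.
move=> x; apply: (@cvgM _ _ _ (nbhs_filter x)); first exact: cvg_cst.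
exact: (@continuous_prod_coord R S (fun v => v \notin f)).
Qed.

(** The shares other than [x v] are at least 1, hence so is their product. This bounds the feasible
    set, as compactness requires. *)
Lemma feasible_le (R : realType) (S : sgraph) (k : R) (x : S -> R) :
  feasible k x -> forall v, x v <= k.
Proof.
move=> [x1 <-] v; rewrite (bigD1 v) //= ler_peMr //.
  exact: le_trans ler01 (x1 v).
by elim/big_ind: _ => // a b; exact: mulr_ege1.
Qed.

Lemma compact_feasible (R : realType) (S : sgraph) (k : R) :
  compact [set x : S -> R | feasible k x].
Proof.
(* The cube with sides [[1, k]] is compact by Tychonoff, and the level set of the product is closed
   as the preimage of a point. *)
have -> : [set x : S -> R | feasible k x] =
    [set x | forall v, `[1, k]%classic (x v)] `&`
    [set x | \prod_(v : S) x v = k].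
  apply/seteqP; split=> x /=.
    move=> fx; split; last exact: fx.2.
    by move=> v; rewrite in_itv /= fx.1 (feasible_le fx).
  by move=> [xk xp]; split=> // v; move: (xk v); rewrite in_itv /= => /andP[].
apply: compact_closedI.
  apply: (@tychonoff S (fun=> R : topologicalType) (fun=> `[1, k]%classic)) => _.
  exact: segment_compact.
have /continuous_closedP/(_ _ (@closed_eq R k)) :=
  @continuous_prod_coord R S predT.
by [].
Qed.

Lemma min_cost_exists (R : realType) (S : sgraph) (T : finType)
    (sg : T -> {set S * S}) (e : nat) (k : R) (Q : {set T}) :
  (exists x : S -> R, feasible k x) -> exists m, is_min_cost sg e k Q m.
Proof.
move=> ex; have := @compact_EVT_min _ R (cost sg e Q) _ ex
  (@compact_feasible R S k) (continuous_subspaceT (@continuous_cost R S T sg e Q)).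
move=> [x /set_mem fx xmin]; exists (cost sg e Q x); split; first by exists x.
by move=> y fy; apply: xmin; exact/mem_set.
Qed.

End Attained.

(** This is B(x). It does not depend on the group of queries, so it can compare shares that are
    optimal for different subgroups. *)
Definition unit_cost (R : realType) (S : sgraph) (e : nat) (x : S -> R) : R :=
  \sum_(f in edges S) e%:R * \prod_(v | v \notin f) x v.

Section Bounds.
Variables (R : realType) (S : sgraph) (T : finType) (sg : T -> {set S * S}).
Variables (e : nat) (k : R).
Implicit Types (Q : {set T}) (x : S -> R).

Lemma edge_cost_ge0 x (f : {set S}) : feasible k x ->
  0 <= e%:R * \prod_(v | v \notin f) x v.
Proof.
move=> [x1 _]; rewrite mulr_ge0 ?ler0n ?prodr_ge0 // => v _.
exact: le_trans ler01 (x1 v).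
Qed.

Lemma unit_cost_ge0 x : feasible k x -> 0 <= unit_cost e x.
Proof. by move=> fx; apply: sumr_ge0 => f _; exact: edge_cost_ge0. Qed.

Lemma unit_cost_le_cost Q x : feasible k x -> unit_cost e x <= cost sg e Q x.
Proof.
move=> fx; apply: ler_sum => f _; rewrite -mulrA ler_peMl ?edge_cost_ge0 //.
by rewrite ler1n /coef; case: ifP.
Qed.

Lemma cost_le_unit_cost Q x : feasible k x ->
  cost sg e Q x <= unit_cost e x + unit_cost e x.
Proof.
move=> fx; rewrite -mulr2n -mulr_natl mulr_sumr; apply: ler_sum => f _.
rewrite -mulrA ler_wpM2r ?edge_cost_ge0 //.
by rewrite ler_nat /coef; case: ifP.
Qed.

Lemma OPT_le_cost Q x : feasible k x -> OPT sg e k Q <= cost sg e Q x.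
Proof.
by move=> fx; apply: (xgetPex 0 (min_cost_exists _ _ _ _)).2; first exists x.
Qed.

Lemma OPT_attained Q : (exists x : S -> R, feasible k x) ->
  exists2 x : S -> R, feasible k x & cost sg e Q x = OPT sg e k Q.
Proof. by move=> ex; exact: (xgetPex 0 (min_cost_exists sg e Q ex)).1. Qed.

(** Without feasible shares there is no minimum, and [xget] returns its default 0. *)
Lemma OPT_infeasible Q : ~ (exists x : S -> R, feasible k x) ->
  OPT sg e k Q = 0.
Proof. by move=> nex; apply: xgetPN => m [[x fx _] _]; apply: nex; exists x. Qed.

Lemma OPT_ge0 Q : 0 <= OPT sg e k Q.
Proof.
have [ex|/OPT_infeasible ->//] := pselect (exists x : S -> R, feasible k x).
have [x fx <-] := OPT_attained Q ex.
exact: le_trans (unit_cost_ge0 fx) (unit_cost_le_cost _ fx).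
Qed.

Lemma OPT_le_add Q Q1 Q2 : OPT sg e k Q <= OPT sg e k Q1 + OPT sg e k Q2.
Proof.
have [ex|/OPT_infeasible ->] := pselect (exists x : S -> R, feasible k x);
  last by rewrite addr_ge0 ?OPT_ge0.
have [x fx <-] := OPT_attained Q1 ex; have [y fy <-] := OPT_attained Q2 ex.
have lex := unit_cost_le_cost Q1 fx; have ley := unit_cost_le_cost Q2 fy.
(* Whichever of [x] and [y] has the smaller unit cost is used as shares for [Q]; one of its two
   copies of that unit cost is then charged to the other group. *)
have [xy|/ltW yx] := leP (unit_cost e x) (unit_cost e y).
  apply: le_trans (OPT_le_cost Q fx) (le_trans (cost_le_unit_cost Q fx) _).
  exact: lerD lex (le_trans xy ley).
apply: le_trans (OPT_le_cost Q fy) (le_trans (cost_le_unit_cost Q fy) _).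
exact: lerD (le_trans yx lex) ley.
Qed.

End Bounds.

Theorem theorem4p4 (R : realType) (S : sgraph) (T : finType)
    (sg : T -> {set S * S}) (Q : {set T}) (e : nat) (k : R)
    (P : {set {set T}}) :
  1 <= k ->
  (forall q, q \in Q -> is_query (sg q)) ->
  partition P Q ->
  (2 <= #|P|)%N ->
  OPT sg e k Q <= \sum_(Qi in P) OPT sg e k Qi.
Proof.
move=> _ _ _ /card_gt1P[Q1 [Q2 [P1 P2 neq12]]].
(* Two distinct subgroups are split off from the sum; their optima already dominate the left
   side. *)
rewrite (bigD1 Q1) //= (bigD1 Q2) /=; last by rewrite P2 eq_sym.
rewrite addrA (le_trans (OPT_le_add sg e k Q Q1 Q2)) // lerDl.
by apply: sumr_ge0 => Qi _; exact: OPT_ge0.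
Qed.
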